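(* Let $p,q,r$ be distinct primes, and let $\xi\in\mathbb{Z}_q^{\ast}$ satisfy $\xi^p=1$. Suppose that $X$ is an indecomposable cycle set with $|X|=pqr$ whose retraction is $X^{(1)}=\mathbb{Z}_p\times_\Gamma\mathbb{Z}_q$ with $\Gamma(x,y)=\xi^{y-x}$. Then $X\cong\mathbb{Z}_p\times\mathbb{Z}_q\times\mathbb{Z}_r$ with the binary operation $$(x,a,s)\ast(y,b,t)=\bigl(y+1,\ b+\xi^{y-x},\ t+\Phi^0(y-x,\,b-\xi^{y-x}a)\bigr)$$ for some nonconstant map $\Phi^0:\mathbb{Z}_p\times\mathbb{Z}_q\to\mathbb{Z}_r$. On the other hand, each nonconstant map $\Phi^0:\mathbb{Z}_p\times\mathbb{Z}_q\to\mathbb{Z}_r$ defines an indecomposable cycle set on $\mathbb{Z}_p\times\mathbb{Z}_q\times\mathbb{Z}_r$ by means of this operation.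
   Context: A cycle set is a finite set $X$ with a binary operation $\ast$ such that $(x\ast y)\ast(x\ast z)=(y\ast x)\ast(y\ast z)$ for all $x,y,z\in X$, each map $\sigma_x: y\mapsto x\ast y$ is bijective, and $x\mapsto x\ast x$ is bijective (all cycle sets are assumed finite and nondegenerate). $X$ is indecomposable if it has no partition into two nonempty sub-cycle sets; equivalently the permutation group $\mathcal{G}(X)=\langle\sigma_x:x\in X\rangle\leq\mathrm{Sym}(X)$ acts transitively on $X$. The retraction $X^{(1)}=X_{\mathrm{ret}}$ is the quotient of $X$ by the relation $x\sim y\Leftrightarrow\sigma_x=\sigma_y$, with the induced cycle set operation $[x]\ast[y]=[x\ast y]$. $\mathbb{Z}_n=\mathbb{Z}/n\mathbb{Z}$; $\mathbb{Z}_q^{\ast}$ is the group of units of $\mathbb{Z}_q$. For $\Gamma:\mathbb{Z}_p\times\mathbb{Z}_p\to\mathbb{Z}_q$ of the form $\Gamma(x,y)=\Gamma^0(y-x)$, $\mathbb{Z}_p\times_\Gamma\mathbb{Z}_q$ denotes the cycle set on $\mathbb{Z}_p\times\mathbb{Z}_q$ with operation $(x,a)\ast(y,b)=(y+1,b+\Gamma(x,y))$. Since $\xi^p=1$, $\xi^{z}$ is well defined for $z\in\mathbb{Z}_p$. The equality $X^{(1)}=\mathbb{Z}_p\times_\Gamma\mathbb{Z}_q$ is understood as an identification up to isomorphism. *)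

(* Defs.v *)
From HB Require Import structures.
From mathcomp Require Import all_boot all_order all_algebra.
From mathcomp Require Import generic_quotient.

Set Implicit Arguments.
Unset Strict Implicit.
Unset Printing Implicit Defensive.

Import GRing.Theory.
Local Open Scope ring_scope.
Local Open Scope quotient_scope.

Definition cycle_set (T : finType) (op : T -> T -> T) : Prop :=
  [/\ forall x y z, op (op x y) (op x z) = op (op y x) (op y z),
      forall x, bijective (op x)
    & bijective (fun x => op x x)].

(* A subset of a finite cycle set which is closed under the operation is again
   a cycle set: injective self-maps of a finite set are bijective. *)
Definition sub_cycle_set (T : finType) (op : T -> T -> T) (A : {set T}) : Prop :=
  {in A &, forall x y, op x y \in A}.

Definition indecomposable (T : finType) (op : T -> T -> T) : Prop :=
  ~ exists A B : {set T},
      [/\ A != set0 /\ B != set0, A :|: B = [set: T], [disjoint A & B],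
          sub_cycle_set op A & sub_cycle_set op B].

Definition isomorphic (T U : Type) (opT : T -> T -> T) (opU : U -> U -> U) :
    Prop :=
  exists2 f : T -> U, bijective f & forall x y, f (opT x y) = opU (f x) (f y).

Section Retraction.
Variables (T : finType) (op : T -> T -> T).

Definition same_sigma : rel T := fun x y => [forall z, op x z == op y z].

Lemma same_sigmaP x y : reflect (op x =1 op y) (same_sigma x y).
Proof. exact: 'forall_eqP. Qed.

Lemma same_sigma_refl : reflexive same_sigma.
Proof. by move=> x; apply/same_sigmaP. Qed.

Lemma same_sigma_sym : symmetric same_sigma.
Proof. by move=> x y; apply/same_sigmaP/same_sigmaP => h z; rewrite h. Qed.

Lemma same_sigma_trans : transitive same_sigma.
Proof.
move=> y x z /same_sigmaP xy /same_sigmaP yz.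
by apply/same_sigmaP => t; rewrite xy yz.
Qed.

Canonical same_sigma_equiv :=
  EquivRel same_sigma same_sigma_refl same_sigma_sym same_sigma_trans.

Definition retraction : Type := {eq_quot same_sigma}.

HB.instance Definition _ := Quotient.on retraction.
HB.instance Definition _ := [Finite of retraction by <:%/].

Definition ret_class : T -> retraction := \pi_{eq_quot same_sigma}.

Definition ret_op (u v : retraction) : retraction :=
  ret_class (op (repr u) (repr v)).

Lemma ret_classP x y : reflect (ret_class x = ret_class y) (same_sigma x y).
Proof. exact: eqmodP. Qed.

Lemma repr_classK : cancel repr ret_class.
Proof. exact: reprK. Qed.

Hypothesis cs : cycle_set op.

Lemma same_sigma_op x x' y y' :
  same_sigma x x' -> same_sigma y y' -> same_sigma (op x y) (op x' y').
Proof.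
case: cs => cyc bij _ /same_sigmaP xx' /same_sigmaP yy'; rewrite -xx'.
apply/same_sigmaP => z; have [g _ gK] := bij x.
by rewrite -(gK z) (cyc x y) (cyc x y') !yy'.
Qed.

(* The operation on representatives is the induced one, [x] * [y] = [x * y]. *)
Lemma ret_opE x y : ret_op (ret_class x) (ret_class y) = ret_class (op x y).
Proof.
by apply/ret_classP/same_sigma_op; apply/ret_classP; rewrite repr_classK.
Qed.

Lemma ret_cycle_set : cycle_set ret_op.
Proof.
have surj_bij (f : retraction -> retraction) (h : T -> T) :
    bijective h -> (forall x, f (ret_class x) = ret_class (h x)) -> bijective f.
  move=> [g _ gK] fE; pose k (u : retraction) := ret_class (g (repr u)).
  have kK : cancel k f by move=> u; rewrite /k fE gK repr_classK.
  by apply: (bij_can_bij _ kK); apply: injF_bij; apply: can_inj kK.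
have classW (P : retraction -> Prop) :
    (forall x, P (ret_class x)) -> forall u, P u.
  by move=> Pc u; rewrite -(repr_classK u).
case: cs => cyc bij dbij; split.
- elim/classW=> x; elim/classW=> y; elim/classW=> z.
  by rewrite !ret_opE (cyc x y).
- by elim/classW=> x; apply: surj_bij (bij x) _ => y; rewrite ret_opE.
- by apply: surj_bij dbij _ => x; rewrite ret_opE.
Qed.

End Retraction.

Definition nonconstant (A B : Type) (f : A -> B) : Prop :=
  exists x y, f x <> f y.

(* [xi ^ z] for an exponent [z] modulo [p], read off the representative of [z]
   in [0, p); it is only meaningful when [xi ^+ p = 1]. *)
Definition zpow (p q : nat) (xi : 'Z_q) (z : 'Z_p) : 'Z_q :=
  xi ^+ (z : nat).

Definition ext_op (p q : nat) (Gamma : 'Z_p -> 'Z_p -> 'Z_q)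
    (u v : 'Z_p * 'Z_q) : 'Z_p * 'Z_q :=
  let: (x, _) := u in let: (y, b) := v in (y + 1, b + Gamma x y).

Definition triple_op (p q r : nat) (xi : 'Z_q) (Phi0 : 'Z_p * 'Z_q -> 'Z_r)
    (u v : 'Z_p * 'Z_q * 'Z_r) : 'Z_p * 'Z_q * 'Z_r :=
  let: (x, a, _) := u in let: (y, b, t) := v in
  (y + 1, b + zpow xi (y - x),
   t + Phi0 (y - x, b - zpow xi (y - x) * a)).

(* Main.v *)
Require Import Defs.
From mathcomp Require Import all_boot all_order all_fingroup all_algebra.
From mathcomp Require Import cyclic.

Set Implicit Arguments.
Unset Strict Implicit.
Unset Printing Implicit Defensive.

Import GRing.Theory.
Local Open Scope ring_scope.

(* The permutation group G of X carries a brace structure: its additive law is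
   realised by the maps [omega 1 L], which depend only on the multiset L. The
   group induced on Y = Z_p x_Gamma Z_q acts regularly on Y, with the pair
   (y - x, b - xi^(y - x) a) as complete invariant of the diagonal action on Y^2.
   Hence the kernel K of the action of G on Y, which is the socle of the brace,
   is abelian and transitive on the fibres of X -> Y, so K has exponent r.
   Splitting the additive group into its r-part K and its Hall subgroup H of
   order pq, each sigma_x factors as k_x h_x with k_x in K and h_x in H. Since H
   is regular on Y, an H-orbit is a section of X -> Y; translating it by one
   k in K moved around by H gives coordinates Y x Z_r, in which H preserves the
   third coordinate and k_x adds Phi(x, y) to it. The equivariance
   g k_x g^-1 = k_(g x) makes Phi invariant, i.e. a function Phi0 of the pair
   above.
   Conversely, for a set A stable under all sigma_x, the number N = N(y, b) of
   points of A over (y, b) is constant, and the sum F(y, b) of their third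
   coordinates satisfies F(sigma_x y) = F(y) + N Phi(x, y), which forces N Phi0
   to be constant because q <> r. *)

(** * The permutation group of a cycle set and its additive law *)

Section PermutationGroup.
Local Open Scope group_scope.
Variables (X : finType) (op : X -> X -> X) (cs : cycle_set op).

Let op_inj x : injective (op x).
Proof. by case: cs => _ bij _; apply: bij_inj. Qed.

Definition sigma x : {perm X} := perm (@op_inj x).

Lemma sigmaE x y : sigma x y = op x y.
Proof. exact: permE. Qed.

Lemma sigma_cycle x y :
  sigma x * sigma (op x y) = sigma y * sigma (op y x).
Proof.
by apply/permP => z; rewrite !permM !sigmaE; case: cs => cyc _ _; apply: cyc.
Qed.

Definition cs_group : {group {perm X}} := <<[set sigma x | x : X]>>%G.

Lemma mem_sigma x : sigma x \in cs_group.
Proof. by apply/mem_gen/imsetP; exists x. Qed.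

(* [omega 1 [:: x1; ...; xn]] is, up to inversion, the sum of the elements
   [sigma x1], ..., [sigma xn] in the additive group of the brace structure
   carried by the permutation group. *)
Definition omega : {perm X} -> seq X -> {perm X} :=
  foldl (fun (g : {perm X}) x => g * sigma (g x)).

Lemma omega_cat g L M : omega g (L ++ M) = omega (omega g L) M.
Proof. exact: foldl_cat. Qed.

Lemma omega_rcons g L x :
  omega g (rcons L x) = omega g L * sigma (omega g L x).
Proof. by rewrite /omega foldl_rcons. Qed.

Lemma omega_in g L : g \in cs_group -> omega g L \in cs_group.
Proof.
by elim: L g => //= x L IH g Gg; apply: IH; rewrite groupM ?mem_sigma.
Qed.

Lemma omega1_in L : omega 1 L \in cs_group.
Proof. exact: omega_in. Qed.

(** Adjacent letters [x], [y] contribute [sigma (g x) * sigma (op (g x) (g y))], which [sigma_cycle]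
    makes symmetric in [x] and [y]. *)
Lemma omega_perm g L M : perm_eq L M -> omega g L = omega g M.
Proof.
move: g; have move_head x L1 L2 g :
    omega g (x :: L1 ++ L2) = omega g (L1 ++ x :: L2).
  elim: L1 g => //= y L1 IH g; rewrite -IH /=; congr (omega _ (_ ++ _)).
  by rewrite !permM !sigmaE -!mulgA sigma_cycle.
have swap L1 L2 L3 g : omega g (L1 ++ L2 ++ L3) = omega g (L2 ++ L1 ++ L3).
  elim: L1 g => //= x L1 IH g.
  by rewrite IH -move_head.
by move=> g LM; apply: (catCA_perm_subst (F := omega g)) LM => *; apply: swap.
Qed.

Lemma omega_map g h L : omega (g * h) L = g * omega h (map g L).
Proof. by elim: L h => //= x L IH h; rewrite -mulgA permM IH. Qed.

Lemma omega_mapl g L : omega g L = g * omega 1 (map g L).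
Proof. by rewrite -omega_map mulg1. Qed.

Lemma cs_group_omega g : g \in cs_group -> exists L, g = omega 1 L.
Proof.
case/gen_prodgP=> n [c cP ->].
elim: n c cP => [|n IH] c cP; first by exists [::]; rewrite big_ord0.
rewrite big_ord_recr /=; have [|L ->] := IH (fun i => c (widen_ord (leqnSn n) i)).
  by move=> i; apply: cP.
have /imsetP[x _ ->] := cP ord_max.
(* The new letter is pulled back through the product so far, so that [omega] appends exactly
   [sigma x]. *)
by exists (rcons L ((omega 1 L)^-1 x)); rewrite omega_rcons permKV.
Qed.

Lemma indecomposable_trans x y :
  indecomposable op -> exists2 g, g \in cs_group & g x = y.
Proof.
move=> ind; suff /orbitP[g Gg /= gx] : y \in orbit 'P%act cs_group x by exists g.
case: (boolP (y \in _)) => // yO; case: ind; pose O := orbit 'P%act cs_group x.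
have OJ z t : (op z t \in O) = (t \in O).
  by rewrite -sigmaE; apply: (orbit_actr 'P%act); apply: mem_sigma.
exists [set z in O], (~: [set z in O]); split.
- by split; apply/set0Pn; [exists x | exists y]; rewrite !inE ?orbit_refl.
- by rewrite setUCr.
- by rewrite -setI_eq0 setICr.
- by move=> z t; rewrite !inE => _; rewrite OJ.
- by move=> z t; rewrite !inE => _; rewrite OJ.
Qed.

(** By finiteness [sigma z] maps the part containing [z] onto itself, hence also preserves the
    complementary part. *)
Lemma decomposition_stable (A B : {set X}) :
    A :|: B = [set: X] -> [disjoint A & B] ->
    sub_cycle_set op A -> sub_cycle_set op B ->
  forall z t, (op z t \in A) = (t \in A).
Proof.
move=> AB dAB sA sB z t.
have BE : B = ~: A by apply/setP=> x; have /setP/(_ x) := AB;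
  have /disjoint_setI0/setP/(_ x) := dAB; rewrite !inE;
  case: (x \in A); case: (x \in B).
have stab (C : {set X}) : sub_cycle_set op C -> z \in C ->
    forall u, (op z u \in C) = (u \in C).
  move=> sC zC u; have CE : sigma z @: C = C.
    apply/eqP; rewrite eqEcard card_imset ?leqnn ?andbT; last exact: perm_inj.
    by apply/subsetP => _ /imsetP[v vC ->]; rewrite sigmaE; apply: sC.
  by rewrite -sigmaE -{1}CE mem_imset //; apply: perm_inj.
case: (boolP (z \in A)) => [zA | zA]; first exact: stab.
have /stab/(_ _ t) := sB; rewrite BE !inE => /(_ zA).
by move/negb_inj.
Qed.
End PermutationGroup.

(** * Arithmetic modulo n and powers of xi *)

Lemma Zp_natr_modn n m : (1 < n)%N -> ((m %% n)%N%:R : 'Z_n) = m%:R.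
Proof. by move=> n1; apply: val_inj; rewrite /= !val_Zp_nat // modn_mod. Qed.

Lemma Zp_natr_dvd n m : (1 < n)%N -> (n %| m)%N -> (m%:R : 'Z_n) = 0.
Proof. by move=> n1 /eqP nm; rewrite -Zp_natr_modn // nm. Qed.

Lemma Zp_mulrn_mod n a b (x : 'Z_n) :
  (1 < n)%N -> a = b %[mod n] -> x *+ a = x *+ b.
Proof.
move=> n1 ab; rewrite -(mulr_natr x a) -(mulr_natr x b) -(Zp_natr_modn a) //.
by rewrite ab Zp_natr_modn.
Qed.

Lemma card_Zp_prime n : prime n -> #|'Z_n| = n.
Proof. by move=> n_pr; rewrite card_ord Zp_cast ?prime_gt1. Qed.

Lemma Zp_prime_unit n (x : 'Z_n) : prime n -> x != 0 -> x \is a GRing.unit.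
Proof.
move=> n_pr; rewrite -(natr_Zp x) unitZpE ?prime_gt1 // prime_coprime //.
by apply: contraNN => nx; rewrite Zp_natr_dvd ?prime_gt1.
Qed.

Section Zpow.
Variables (p q : nat) (p_pr : prime p) (xi : 'Z_q) (xi_p : xi ^+ p = 1).

Lemma zpow0 : zpow xi (0 : 'Z_p) = 1.
Proof. by []. Qed.

Lemma zpowD (a b : 'Z_p) : zpow xi (a + b) = zpow xi a * zpow xi b.
Proof.
by rewrite /zpow -exprD /= expr_mod // Zp_cast ?prime_gt1.
Qed.

Lemma zpowNK (a : 'Z_p) : zpow xi a * zpow xi (- a) = 1.
Proof. by rewrite -zpowD subrr. Qed.

Lemma zpowVK (a : 'Z_p) : zpow xi (- a) * zpow xi a = 1.
Proof. by rewrite -zpowD addNr. Qed.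
End Zpow.

(** Under [omega 1], this word stands for the [n]-fold additive multiple of the brace element given
    by [L]. *)
Definition repeat_seq (T : Type) n (L : seq T) := flatten (nseq n L).

Lemma repeat_seqM (T : Type) m n (L : seq T) :
  repeat_seq m (repeat_seq n L) = repeat_seq (m * n) L.
Proof.
elim: m => //= m IH; rewrite mulSn [RHS]/repeat_seq nseqD flatten_cat.
by congr (_ ++ _).
Qed.

Lemma repeat_seq1 (T : Type) n (x : T) : repeat_seq n [:: x] = nseq n x.
Proof. by elim: n => //= n <-. Qed.

Lemma size_repeat_seq (T : Type) n (L : seq T) :
  size (repeat_seq n L) = (n * size L)%N.
Proof. by elim: n => //= n IH; rewrite size_cat IH mulSn. Qed.

Lemma repeat_seq_cat (T : eqType) n (L M : seq T) :
  perm_eq (repeat_seq n (L ++ M)) (repeat_seq n L ++ repeat_seq n M).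
Proof.
elim: n => // n IH; rewrite /repeat_seq /= -/(repeat_seq _ _).
rewrite -!catA perm_cat2l perm_sym perm_catCA perm_cat2l perm_sym.
exact: IH.
Qed.

Lemma perm_expg_inj (T : finType) (k : {perm T}) x r m n : prime r ->
  (k ^+ r = 1)%g -> k x != x -> (k ^+ m)%g x = (k ^+ n)%g x -> m = n %[mod r].
Proof.
move=> r_pr kr kx; wlog le_mn : m n / (m <= n)%N.
  by move=> W kmn; case/orP: (leq_total m n) => /W -> //.
rewrite -{1}(subnK le_mn) expgD permM => /perm_inj /esym kd.
apply/esym/eqP; rewrite eqn_mod_dvd //; apply: contraNT kx => nd.
(* Bezout: otherwise [k] is a power of [k ^+ (n - m)], up to powers of [k ^+ r = 1], and so fixes
   [x]. *)
have /coprimeP[|[a b] /= ab] : coprime (n - m) r.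
- by rewrite coprime_sym prime_coprime.
- by rewrite lt0n; apply: contra nd => /eqP ->.
have fix_exp i : ((k ^+ (n - m)) ^+ i)%g x = x.
  by elim: i => [|i IH]; rewrite ?perm1 // expgS permM kd.
rewrite -{2}(fix_exp a) -expgM mulnC -[(a * _)%N](@subnK (b * r)).
  by rewrite ab expgD (mulnC b) expgM kr expg1n permM perm1 expg1.
by rewrite ltnW // -subn_gt0 ab.
Qed.

(** * The action induced on the retraction *)

Definition pair_inv p q (xi : 'Z_q) (u v : 'Z_p * 'Z_q) : 'Z_p * 'Z_q :=
  (v.1 - u.1, v.2 - zpow xi (v.1 - u.1) * u.2).

Section Extension.
Variables (p q r : nat).
Hypotheses (p_pr : prime p) (q_pr : prime q) (r_pr : prime r).
Hypotheses (p_neq_r : p <> r) (q_neq_r : q <> r).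
Variables (xi : 'Z_q) (xi_p : xi ^+ p = 1).
Variables (X : finType) (op : X -> X -> X).
Hypotheses (cs : cycle_set op) (ind : indecomposable op).
Hypothesis cardX : #|X| = (p * q * r)%N.
Variable P : X -> 'Z_p * 'Z_q.
Hypothesis P_op :
  forall u v, P (op u v) = ext_op (fun x y => zpow xi (y - x)) (P u) (P v).
Hypothesis P_sigma : forall u v, P u = P v <-> sigma cs u = sigma cs v.
Hypothesis P_surj : forall y, exists u, P u = y.

Local Notation sg := (sigma cs).
Local Notation om := (omega cs).
Local Notation G := (cs_group cs).

Let p_gt1 : (1 < p)%N. Proof. exact: prime_gt1. Qed.
Let q_gt1 : (1 < q)%N. Proof. exact: prime_gt1. Qed.
Let r_gt1 : (1 < r)%N. Proof. exact: prime_gt1. Qed.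

(** Earlier letters shift the first coordinates of [u] and of a later letter equally, so each letter
    contributes independently of its position. *)
Lemma P_omega L u :
  P (om 1%g L u) = ((P u).1 + (size L)%:R,
                    (P u).2 + \sum_(x <- L) zpow xi ((P u).1 - (P x).1)).
Proof.
elim/last_ind: L u => [|L x IH] u.
  by rewrite /= perm1 big_nil !addr0 -surjective_pairing.
rewrite omega_rcons permM sigmaE P_op !IH size_rcons -cats1 big_cat big_seq1 /=.
rewrite -addrA -natr1 addrA; congr (_, _); rewrite [RHS]addrA; congr (_ + zpow _ _).
by rewrite opprD addrACA subrr addr0.
Qed.

Lemma P_omega_repeat n L u :
  P (om 1%g (repeat_seq n L) u) =
    ((P u).1 + (size L)%:R *+ n,
     (P u).2 + (\sum_(x <- L) zpow xi ((P u).1 - (P x).1)) *+ n).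
Proof.
rewrite P_omega size_repeat_seq mulnC natrM mulr_natr; congr (_, _ + _).
by elim: n => [|n IH]; rewrite /= ?big_nil // big_cat IH mulrS.
Qed.

Lemma P_cs_group g u v : g \in G -> P u = P v -> P (g u) = P (g v).
Proof. by case/cs_group_omega=> L -> uv; rewrite !P_omega uv. Qed.

(** By [P_omega], the second coordinate of [P v] moves by [zpow xi ((P v).1 - (P u).1)] times the
    displacement of that of [P u], so the displacements cancel. *)
Lemma pair_inv_cs_group g u v : g \in G ->
  pair_inv xi (P (g u)) (P (g v)) = pair_inv xi (P u) (P v).
Proof.
case/cs_group_omega=> L ->; rewrite !P_omega /pair_inv /=.
have E : (P v).1 + (size L)%:R - ((P u).1 + (size L)%:R) = (P v).1 - (P u).1.
  by rewrite opprD addrACA subrr addr0.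
rewrite E; congr (_, _); rewrite mulrDr mulr_sumr opprD addrACA.
rewrite [X in _ + (_ - X)](eq_bigr (fun x => zpow xi ((P v).1 - (P x).1)))
  ?subrr ?addr0 // => x _.
by rewrite -zpowD // addrA subrK.
Qed.

Lemma pair_inv_inj u : injective (@pair_inv p q xi u).
Proof.
move=> [x a] [y b] /eqP; rewrite xpair_eqE /= => /andP[/eqP/addIr ->].
by move=> /eqP/addIr ->.
Qed.

Lemma pair_inv_injl v : injective (@pair_inv p q xi ^~ v).
Proof.
move=> [x a] [y b] /eqP; rewrite xpair_eqE /= => /andP[/eqP/addrI/oppr_inj ->].
move=> /eqP/addrI/oppr_inj E.
congr (_, _); rewrite -[a]mul1r -[b]mul1r -(zpowVK p_pr xi_p (v.1 - y)).
by rewrite -!mulrA E.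
Qed.

(** * The socle *)

Section Kernel.
Local Open Scope group_scope.

Definition kernel_set : {set {perm X}} :=
  [set g in G | [forall x, P (g x) == P x]].

Lemma kernelP g : reflect (g \in G /\ forall x, P (g x) = P x) (g \in kernel_set).
Proof. by rewrite inE; apply: (iffP andP) => -[Gg /'forall_eqP Pg]. Qed.

Lemma kernel_group_set : group_set kernel_set.
Proof.
apply/group_setP; split.
  by apply/kernelP; split=> [|x]; rewrite ?group1 ?perm1.
move=> g h /kernelP[Gg Pg] /kernelP[Gh Ph]; apply/kernelP.
by split=> [|x]; rewrite ?groupM // permM Ph.
Qed.

Canonical kernel := Group kernel_group_set.
Local Notation K := kernel.

Lemma kernel_sub g : g \in K -> g \in G. Proof. by case/kernelP. Qed.

(** The induced action is free: once [P x] is fixed, the pair invariant determines every other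
    point. *)
Lemma kernel_fix g x : g \in G -> P (g x) = P x -> g \in K.
Proof.
move=> Gg gx; apply/kernelP; split=> // y; apply: (pair_inv_inj (u := P x)).
by rewrite -{1}gx pair_inv_cs_group.
Qed.

Lemma kernelJ g k : g \in G -> k \in K -> k ^ g \in K.
Proof.
move=> Gg /kernelP[Gk Pk]; apply/kernelP; split=> [|x]; first exact: groupJ.
by rewrite -[x](permKV g) permJ; apply: P_cs_group.
Qed.

Lemma omega_congr g L M : g \in G -> map P L = map P M -> om g L = om g M.
Proof.
elim: L M g => [|x L IH] [|y M] g //= Gg [xy LM].
have /P_sigma -> : P (g x) = P (g y) by apply: P_cs_group.
by apply: IH; rewrite // groupM ?mem_sigma.
Qed.

(** [omega] sees letters only through [P], which [g] preserves, so adding to a socle element is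
    multiplying by it. *)
Lemma omega_kernel g L : g \in K -> om g L = g * om 1 L.
Proof.
case/kernelP=> Gg Pg; rewrite omega_mapl; congr (_ * _).
apply: omega_congr; rewrite ?group1 // -map_comp; apply: eq_map => x.
exact: Pg.
Qed.

Lemma omega_repeat_kernel n L : om 1 L \in K -> om 1 (repeat_seq n L) = om 1 L ^+ n.
Proof.
move=> KL; elim: n => [|n IH] //=; rewrite omega_cat omega_kernel //.
by rewrite IH expgS.
Qed.

(* Addition in the brace agrees with composition on its socle, hence the socle
   is commutative. *)
Lemma kernel_abelian : abelian K.
Proof.
apply/centsP => g Kg h Kh; rewrite /commute.
have [L gL] := cs_group_omega (kernel_sub Kg).
have [M hM] := cs_group_omega (kernel_sub Kh).
rewrite {2}gL {1}hM -!omega_kernel // gL hM -!omega_cat.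
by apply: omega_perm; rewrite perm_catC.
Qed.

Lemma kernel_trans u v : P u = P v -> exists2 k, k \in K & k u = v.
Proof.
move=> uv; have [g Gg gu] := indecomposable_trans cs u v ind.
by exists g; rewrite // (kernel_fix (x := u)) // gu.
Qed.

Lemma card_fibre u : #|[set v | P v == P u]| = r.
Proof.
have le_fibre v w : (#|[set x | P x == P v]| <= #|[set x | P x == P w]|)%N.
  have [g Gg gv] := indecomposable_trans cs v w ind.
  rewrite -(card_imset _ (@perm_inj _ g)) subset_leq_card //.
  apply/subsetP => _ /imsetP[x /[!inE]/eqP xv ->].
  by rewrite -gv; apply/eqP/P_cs_group.
suff /eqP : #|X| = (p * q * #|[set v | P v == P u]|)%N.
  by rewrite cardX eqn_pmul2l ?muln_gt0 ?prime_gt0 // => /eqP.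
rewrite -[LHS]sum1_card (partition_big P predT) //=.
rewrite (eq_bigr (fun=> #|[set v | P v == P u]|)).
  by rewrite sum_nat_const card_prod !card_Zp_prime.
move=> y _; have [v <-] := P_surj y.
transitivity #|[set x | P x == P v]|; first by rewrite -sum1dep_card.
by apply/eqP; rewrite eqn_leq !le_fibre.
Qed.

Lemma kernel_exponent k : k \in K -> k ^+ r = 1.
Proof.
move=> Kk; apply/permP => x; rewrite perm1.
have Or : #|orbit 'P%act K x| = r.
  rewrite -(card_fibre x); apply: eq_card => y; rewrite inE.
  apply/orbitP/eqP => [[g /kernelP[_ Pg] <-]|yx]; first exact: Pg.
  by have [g Kg gx] := kernel_trans (esym yx); exists g.
have sCK : 'C_K[x | 'P] \subset K by exact: subsetIl.
have nCK : K \subset 'N('C_K[x | 'P]).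
  exact: sub_abelian_norm kernel_abelian sCK.
(* The stabiliser of [x] is normal in the abelian group [K], and its index is the orbit length
   [r]. *)
have : k ^+ r \in 'C_K[x | 'P].
  rewrite coset_idr ?morphX ?groupX ?(subsetP nCK) //.
  rewrite -Or card_orbit -card_quotient //; apply: expg_cardG.
  exact: mem_quotient.
by case/setIP=> _ /astab1P.
Qed.

Lemma P_omega_repeat_mod m n L u : (m = n %[mod p * q])%N ->
  P (om 1 (repeat_seq m L) u) = P (om 1 (repeat_seq n L) u).
Proof.
move=> mn; rewrite !P_omega_repeat; congr (_ + _, _ + _)%R; apply: Zp_mulrn_mod.
- by [].
- by rewrite -(modn_dvdm m (dvdn_mulr q (dvdnn p))) mn modn_dvdm ?dvdn_mulr.
- by [].
- by rewrite -(modn_dvdm m (dvdn_mull p (dvdnn q))) mn modn_dvdm ?dvdn_mull.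
Qed.

Lemma omega_repeat_in_kernel n L :
  (p * q %| n)%N -> om 1 (repeat_seq n L) \in K.
Proof.
move=> pqn; apply/kernelP; split=> [|x]; first exact: omega1_in.
by rewrite (P_omega_repeat_mod (n := 0)) ?perm1 // mod0n; apply/eqP.
Qed.

(** * The Hall subgroup and the factorisation of sigma *)

Let co_pq_r : coprime (p * q)%N r.
Proof.
by rewrite coprimeMl !prime_coprime // !dvdn_prime2 //; apply/andP; split; apply/eqP.
Qed.

(* Multiplication by [ker_exp] and [compl_exp] projects the additive group of
   the brace onto its Sylow r-subgroup (the socle) and onto the complementary
   Hall subgroup. *)
Definition ker_exp := chinese (p * q)%N r 0 1.
Definition compl_exp := chinese (p * q)%N r 1 0.

Lemma dvdn_ker_exp : (p * q %| ker_exp)%N.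
Proof. by apply/eqP; rewrite chinese_modl // mod0n. Qed.

Lemma dvdn_compl_exp : (r %| compl_exp)%N.
Proof. by apply/eqP; rewrite chinese_modr // mod0n. Qed.

Lemma exp_sum : exists j, (ker_exp + compl_exp = p * q * (r * j) + 1)%N.
Proof.
exists ((ker_exp + compl_exp) %/ (p * q * r))%N.
have E : (ker_exp + compl_exp = 1 %[mod p * q * r])%N.
  apply/eqP; rewrite chinese_remainder //; apply/andP.
  by split; rewrite -modnDm ?chinese_modl ?chinese_modr // modnDm.
rewrite {1}(divn_eq (ker_exp + compl_exp)%N (p * q * r)%N) E mulnC mulnA modn_small //.
by rewrite -(muln1 1%N) ltn_mul // -(muln1 1%N) ltn_mul.
Qed.

Definition ker_part x := om 1 (nseq ker_exp x).
Definition compl_part x := om 1 (nseq compl_exp x).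

Lemma ker_part_in x : ker_part x \in K.
Proof. by rewrite /ker_part -repeat_seq1 omega_repeat_in_kernel ?dvdn_ker_exp. Qed.

(** Compute the sum of [ker_part x] and [g] in both orders: it is [ker_part x * g], the first
    summand being in the socle, and also [g * ker_part (g x)]. *)
Lemma ker_partJ g x : g \in G -> ker_part x ^ g = ker_part (g x).
Proof.
move=> Gg; have [L gL] := cs_group_omega Gg.
apply: (mulgI g); rewrite -conjgC /ker_part {1}gL -omega_kernel ?ker_part_in //.
rewrite -omega_cat (omega_perm _ _ (permEl (perm_catC _ _))) omega_cat -gL.
by rewrite omega_mapl map_nseq.
Qed.

Lemma sigma_split x : sg x = ker_part x * compl_part x.
Proof.
rewrite /compl_part -omega_kernel ?ker_part_in // -omega_cat -nseqD.
(* Of the [p * q * (r * j) + 1] copies of [x], all but one cancel: [p * q] copies give a socle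
   element, whose [r]-th power is 1. *)
have [j ->] := exp_sum; have Kpq : om 1 (repeat_seq (p * q)%N [:: x]) \in K.
  by rewrite omega_repeat_in_kernel.
rewrite nseqD omega_cat mulnC -repeat_seq1 -repeat_seqM omega_repeat_kernel //.
by rewrite expgM kernel_exponent // expg1n /= mul1g perm1.
Qed.

Definition complement : {group {perm X}} := <<[set compl_part x | x : X]>>%G.
Local Notation H := complement.

Lemma omega_repeat_compl L : om 1 (repeat_seq compl_exp L) \in H.
Proof.
elim/last_ind: L => [|L x IH].
  suff -> : repeat_seq compl_exp (@nil X) = [::] by rewrite group1.
  by rewrite /repeat_seq; elim: compl_exp.
rewrite -cats1 (omega_perm _ _ (repeat_seq_cat _ _ _)) omega_cat omega_mapl.
rewrite groupM // repeat_seq1 map_nseq.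
by apply: mem_gen; apply: imset_f.
Qed.

(** With [omega_repeat_compl], this identifies the subgroup generated under composition with the
    additive multiples by [compl_exp]. *)
Lemma compl_omega h : h \in H -> exists L, h = om 1 (repeat_seq compl_exp L).
Proof.
case/gen_prodgP=> n [c cP ->].
elim: n c cP => [|n IH] c cP.
  by exists [::]; rewrite big_ord0 /repeat_seq; elim: compl_exp.
rewrite big_ord_recr /=; have [|L ->] := IH (fun i => c (widen_ord (leqnSn n) i)).
  by move=> i; apply: cP.
have /imsetP[x _ ->] := cP ord_max.
exists (rcons L ((om 1 (repeat_seq compl_exp L))^-1 x)); rewrite -cats1.
rewrite (omega_perm _ _ (repeat_seq_cat _ _ _)) omega_cat [RHS]omega_mapl.
by rewrite repeat_seq1 map_nseq permKV.
Qed.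

Lemma compl_sub h : h \in H -> h \in G.
Proof. by case/compl_omega=> L ->; apply: omega1_in. Qed.

(** The order of [h] divides [r], by the exponent of [K], and [p * q]: in the socle powers are
    additive multiples, and [p * q * compl_exp] is a multiple of [p * q * r]. *)
Lemma compl_kernel h : h \in H -> h \in K -> h = 1.
Proof.
move=> Hh Kh; have hr := kernel_exponent Kh.
have hpq : h ^+ (p * q)%N = 1.
  have [L hL] := compl_omega Hh; rewrite hL in Kh *.
  rewrite -omega_repeat_kernel // repeat_seqM mulnC -repeat_seqM.
  rewrite omega_repeat_kernel ?omega_repeat_in_kernel //.
  have /dvdnP[j ->] := dvdn_compl_exp.
  by rewrite (mulnC j) expgM kernel_exponent ?expg1n ?omega_repeat_in_kernel.
apply/eqP; rewrite -order_eq1 -dvdn1 -(eqP co_pq_r) dvdn_gcd.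
by rewrite !order_dvdn hr hpq !eqxx.
Qed.

Lemma compl_inj g h x : g \in H -> h \in H -> P (g x) = P (h x) -> g = h.
Proof.
move=> Hg Hh gh; have Hgh : g * h^-1 \in H by rewrite groupM ?groupV.
apply: (mulIg h^-1); rewrite mulgV; apply: compl_kernel => //.
apply: (kernel_fix (x := x)); first exact: compl_sub.
rewrite permM -[in RHS](permK h x); apply: P_cs_group gh.
by rewrite groupV compl_sub.
Qed.

(** Since [compl_exp] is 1 modulo [p * q], multiplying an element of [G] by it leaves its action on
    the retraction unchanged. *)
Lemma compl_trans x y : exists2 h, h \in H & P (h x) = y.
Proof.
have [u <-] := P_surj y; have [g Gg <-] := indecomposable_trans cs x u ind.
have [L ->] := cs_group_omega Gg.
exists (om 1 (repeat_seq compl_exp L)); first exact: omega_repeat_compl.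
rewrite (P_omega_repeat_mod (n := 1)) ?chinese_modl //.
by rewrite /repeat_seq /= cats0.
Qed.

Lemma ker_part_congr x y : P x = P y -> ker_part x = ker_part y.
Proof. by move=> xy; apply: omega_congr; rewrite ?group1 // !map_nseq xy. Qed.

Lemma compl_partP x u : P (compl_part x u) = P (op x u).
Proof.
have /kernelP[_ KP] := ker_part_in x.
by rewrite -sigmaE sigma_split permM; apply: P_cs_group; rewrite ?omega1_in ?KP.
Qed.
End Kernel.

Local Notation K := kernel.
Local Notation H := complement.

(** * Coordinates on X *)

Lemma extension_form :
  exists Phi0 : 'Z_p * 'Z_q -> 'Z_r,
    nonconstant Phi0 /\ isomorphic op (triple_op xi Phi0).
Proof.
have [x0 Px0] := P_surj (0, 0).
have [hh hhH Phh] := fin_all_exists2 (fun y => compl_trans x0 y).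
have hhG y : hh y \in G by apply: compl_sub.
have [k Kk kx0] : exists2 k, k \in K & k x0 != x0.
  have /card_gt1P[u [v []]] : (1 < #|[set v | P v == P x0]|)%N by rewrite card_fibre.
  rewrite !inE => /eqP Pu /eqP Pv uv.
  have [g Kg gu] := kernel_trans (esym Pu); have [h Kh hv] := kernel_trans (esym Pv).
  case: (eqVneq u x0) uv => [-> | ux _]; last by exists g; rewrite ?gu.
  by rewrite eq_sym => vx; exists h; rewrite ?hv.
have kr := kernel_exponent Kk.
have ltr (s : 'Z_r) : (s < r)%N by rewrite -[X in (_ < X)%N](Zp_cast r_gt1).
have k_inj (s t : 'Z_r) : (k ^+ s)%g x0 = (k ^+ t)%g x0 -> s = t.
  by move/(perm_expg_inj r_pr kr kx0); rewrite !modn_small // => /val_inj.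
have kD (s t : 'Z_r) : (k ^+ (s + t)%R = k ^+ s * k ^+ t)%g.
  by rewrite -expgD -(expg_mod (s + t) kr) -[X in (_ %% X)%N](Zp_cast r_gt1).
(* The points [hh y x0] form a section; the conjugate of [k] by [hh y] parametrises the fibre over
   [y]. *)
pose phi (w : 'Z_p * 'Z_q * 'Z_r) := hh w.1 ((k ^+ w.2)%g x0).
have P_phi w : P (phi w) = w.1.
  rewrite -[RHS](Phh w.1); apply: P_cs_group => //.
  by have /kernelP[_] := groupX w.2 Kk.
have phi_inj : injective phi.
  move=> [y s] [z t] E; have := P_phi (y, s); rewrite E P_phi /= => yz.
  by move: E; rewrite yz /phi /= => /perm_inj/k_inj ->.
have [f phiK fK] : bijective phi.
  by apply: inj_card_bij phi_inj _; rewrite cardX !card_prod !card_Zp_prime.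
(* [ker_part w x0] stays in the fibre of [x0], where [hh] is the identity. *)
have /fin_all_exists[c cP] w : exists t : 'Z_r, ker_part w x0 = (k ^+ t)%g x0.
  have := fK (ker_part w x0); case: (f _) => y t E.
  have /kernelP[_ KP] := ker_part_in w.
  have Py : y = P x0 by rewrite -KP -E P_phi.
  have hy1 : hh y = 1%g.
    by apply: (compl_inj (x := x0)); rewrite ?group1 // Phh perm1.
  by exists t; rewrite -E /phi /= hy1 perm1.
have c_congr v w : P v = P w -> c v = c w.
  by move=> /ker_part_congr E; apply: k_inj; rewrite -!cP E.
have sg_phi u y t :
    op u (phi (y, t)) =
    phi (ext_op (fun x z : 'Z_p => zpow xi (z - x)) (P u) y,
         t + c ((hh y)^-1%g u)).
  rewrite -sigmaE sigma_split permM /phi /=.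
  (* Moving [ker_part u] past [hh y] conjugates it to [ker_part ((hh y)^-1 u)], which commutes with
     [k]. *)
  have -> : ker_part u (hh y ((k ^+ t)%g x0)) =
            hh y ((k ^+ (t + c ((hh y)^-1%g u))%R)%g x0).
    rewrite -{1}[u](permKV (hh y)) -ker_partJ // permJ; congr (hh y _).
    rewrite addrC kD [RHS]permM -cP -!permM.
    by congr (fun_of_perm _ _); apply: (centsP kernel_abelian); rewrite ?groupX ?ker_part_in.
  rewrite -permM; congr (fun_of_perm _ _).
  apply: (compl_inj (x := x0)); rewrite ?hhH ?groupM //.
    by apply: mem_gen; apply: imset_f.
  by rewrite Phh permM compl_partP P_op Phh.
(* [w v] is chosen so that the pair formed by [P (w v)] and [P x0] has invariant [v]. *)
have /fin_all_exists[w Pw] (v : 'Z_p * 'Z_q) :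
    exists u, P u = (- v.1, - (zpow xi (- v.1) * v.2)).
  exact: P_surj.
pose Phi0 v := c (w v).
have Phi0E u y : c ((hh y)^-1%g u) = Phi0 (pair_inv xi (P u) y).
  apply: c_congr; apply: (@pair_inv_injl (P x0)).
  rewrite -(pair_inv_cs_group _ _ (hhG y)) permKV Phh Px0 Pw.
  rewrite [RHS]/pair_inv /= !sub0r !opprK mulrN opprK mulrA zpowNK // mul1r.
  by [].
have op_phi u v : op (phi u) (phi v) = phi (triple_op xi Phi0 u v).
  case: v => y t; rewrite sg_phi Phi0E P_phi.
  by case: u y => [[x a] s] [y b].
exists Phi0; split; last first.
  exists f => [|u v]; first by exists phi.
  by apply: (can_inj phiK); rewrite fK -op_phi !fK.
(* These points have different [sigma], but equal first coordinates, so they act alike on the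
   retraction and only [Phi0] can tell them apart. *)
have [u Pu] := P_surj (0, 0); have [v Pv] := P_surj (0, 1).
have [z uvz] : exists z, op u z != op v z.
  apply/existsP; rewrite -negb_forall; apply/negP => /'forall_eqP uv.
  have /P_sigma : sg u = sg v by apply/permP => z; rewrite !sigmaE.
  by rewrite Pu Pv => /eqP; rewrite xpair_eqE /= eq_sym oner_eq0.
exists (pair_inv xi (P u) (f z).1), (pair_inv xi (P v) (f z).1) => E.
case/eqP: uvz; rewrite -(fK z); case: (f z) E => y t E.
by rewrite !sg_phi !Phi0E E Pu Pv; case: y {E}.
Qed.
End Extension.

(** * The converse: indecomposability of the constructed cycle sets *)

Section TripleOp.
Variables (p q r : nat).
Hypotheses (p_pr : prime p) (q_pr : prime q) (r_pr : prime r).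
Hypotheses (p_neq_q : p <> q) (q_neq_r : q <> r).
Variables (xi : 'Z_q) (xi_p : xi ^+ p = 1).

Let p_gt1 : (1 < p)%N. Proof. exact: prime_gt1. Qed.
Let q_gt1 : (1 < q)%N. Proof. exact: prime_gt1. Qed.
Let r_gt1 : (1 < r)%N. Proof. exact: prime_gt1. Qed.

Lemma shift_invariant_const (V : Type) (N : 'Z_p * 'Z_q -> V) :
  (forall (z : 'Z_p) y b, N (y + 1, b + zpow xi z) = N (y, b)) ->
  forall u v, N u = N v.
Proof.
move=> Nshift.
have N1 y b : N (y + 1, b + 1) = N (y, b) := Nshift 0 y b.
have Nxi y b : N (y + 1, b + xi) = N (y, b) := Nshift 1 y b.
(* The shifts (1, 1) and (1, xi) differ by a vertical one; if xi = 1, take [p] times (1, 1), with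
   [p] invertible modulo [q]. *)
have [d d0 Nd] : exists2 d, d != 0 & forall y b, N (y, b + d) = N (y, b).
  have [xi1 | xi1] := eqVneq xi 1.
    exists p%:R.
      suff : (p%:R : 'Z_q) \is a GRing.unit.
        by apply: contraTneq => ->; rewrite unitr0.
      by rewrite unitZpE // prime_coprime // dvdn_prime2 // eq_sym; apply/eqP.
    move=> y b; have Nn n : N (y + n%:R, b + n%:R) = N (y, b).
      elim: n => [|n IH]; first by rewrite !addr0.
      by rewrite -!natr1 !addrA N1.
    by rewrite -[RHS](Nn p) pchar_Zp // addr0.
  exists (1 - xi) => [|y b]; first by rewrite subr_eq0 eq_sym.
  by rewrite -[y](subrK 1) (addrC 1) addrA N1 -(Nxi _ (b - xi)) !subrK.
have Nfst y b : N (y, b) = N (y, 0).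
  have {1}-> : b = 0 + d *+ (b / d : 'Z_q).
    by rewrite add0r -mulr_natr natr_Zp mulrC divrK // Zp_prime_unit.
  elim: (nat_of_ord _) => [|n IH]; first by rewrite addr0.
  by rewrite mulrSr addrA Nd.
have N0 y : N (y, 0) = N (0, 0).
  rewrite -(natr_Zp y); elim: (nat_of_ord y) => [|n IH] //.
  by rewrite -natr1 -IH -(N1 n%:R 0) [RHS]Nfst.
by case=> [y b] [y' b']; rewrite Nfst [RHS]Nfst !N0.
Qed.

Lemma coboundary_const (F psi : 'Z_p * 'Z_q -> 'Z_r) :
  (forall (z : 'Z_p) y b a,
    F (y + 1, b + zpow xi z) = F (y, b) + psi (z, b - zpow xi z * a)) ->
  forall u v, psi u = psi v.
Proof.
(* The left-hand side of the hypothesis does not involve [a], which is free. *)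
move=> Fpsi; have psi1 z d : psi (z, d) = psi (z, 0).
  have := Fpsi z 0 d 0; rewrite (Fpsi _ _ _ (zpow xi (- z) * d)).
  by rewrite mulrA zpowNK // mul1r mulr0 subr0 subrr => /addrI.
have F1 z y b : F (y + 1, b + zpow xi z) = F (y, b) + psi (z, 0).
  by rewrite (Fpsi _ _ _ 0) psi1.
have psi2 z z' : psi (z, 0) = psi (z', 0).
  pose d := zpow xi z - zpow xi z'; pose c := psi (z, 0) - psi (z', 0).
  (* Comparing [z] with [z'] shows that a shift by [d] adds [c]; after [q] shifts [d] vanishes, so
     [c] times [q] is 0 in ['Z_r], where [q] is a unit. *)
  have Fd n : F (0, d *+ n) = F (0, 0) + c *+ n.
    elim: n => [|n IH]; first by rewrite addr0.
    apply: (@addIr _ (psi (z', 0))); rewrite -F1 mulrSr -addrA [d + _]subrK F1 IH.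
    by rewrite mulrSr -!addrA addNr addr0.
  have /esym/eqP := Fd q; rewrite -(mulr_natr d) -(mulr_natr c) pchar_Zp //.
  rewrite mulr0 -[X in _ == X]addr0 (inj_eq (addrI _)) => /eqP c0.
  apply/eqP; rewrite -subr_eq0 -/c; apply/eqP.
  apply: (@mulIr _ q%:R); last by rewrite c0 mul0r.
  by rewrite unitZpE // prime_coprime // dvdn_prime2 // eq_sym; apply/eqP.
by case=> [z d] [z' d']; rewrite psi1 [RHS]psi1 (psi2 z z').
Qed.

Variable Phi0 : 'Z_p * 'Z_q -> 'Z_r.
Local Notation op := (triple_op xi Phi0).

Lemma triple_op_cycle_set : cycle_set op.
Proof.
split.
- move=> [[x a] s] [[y b] t] [[z c] m] /=.
  have subDD (V : zmodType) (u v w : V) : u + w - (v + w) = u - v.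
    by rewrite opprD addrACA subrr addr0.
  have zpow_trans (u v w : 'Z_p) : zpow xi (u - v) * zpow xi (v - w) = zpow xi (u - w).
    by rewrite -zpowD // addrA subrK.
  rewrite !subDD !mulrDr !zpow_trans !subDD.
  by congr (_, _, _); rewrite -!addrA; congr (_ + _); rewrite addrC.
- move=> [[x a] s]; apply: injF_bij => -[[y b] t] [[z c] m] /= /eqP.
  rewrite !xpair_eqE => /andP[/andP[/eqP/addIr ->]].
  by move=> /eqP/addIr -> /eqP/addIr ->.
- apply: injF_bij => -[[y b] t] [[z c] m] /= /eqP.
  rewrite !subrr !zpow0 !mul1r !subrr !xpair_eqE.
  by move=> /andP[/andP[/eqP/addIr -> /eqP/addIr ->] /eqP/addIr ->].
Qed.

Lemma triple_op_indecomposable : nonconstant Phi0 -> indecomposable op.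
Proof.
move=> [u0 [v0 Phi_neq]] [A [B [[A0 B0] AB dAB sA sB]]]; apply: Phi_neq.
have stab := decomposition_stable triple_op_cycle_set AB dAB sA sB.
pose fibre v := [set t | (v, t) \in A].
have fibreD (z : 'Z_p) y b a :
    fibre (y + 1, b + zpow xi z) =
    [set t + Phi0 (z, b - zpow xi z * a) | t in fibre (y, b)].
  (* The acting point realises an arbitrary difference [z] and an arbitrary [a]; its third
     coordinate is immaterial. *)
  have opE t : op (y - z, a, 0) (y, b, t) =
      (y + 1, b + zpow xi z, t + Phi0 (z, b - zpow xi z * a)).
    by rewrite /= opprB [y + (z - y)]addrC subrK.
  apply/setP => t; rewrite inE; apply/idP/imsetP => [At | [s]].
    exists (t - Phi0 (z, b - zpow xi z * a)); last by rewrite subrK.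
    by rewrite inE -(stab (y - z, a, 0)) opE subrK.
  by rewrite inE -(stab (y - z, a, 0)) opE => As ->.
have card_fibre_const : forall v w, #|fibre v| = #|fibre w|.
  apply: shift_invariant_const => z y b.
  by rewrite (fibreD z y b 0) card_imset //; apply: addIr.
pose k := #|fibre (0, 0)|.
(* [A] being nonempty gives [0 < k], and [B] being nonempty gives [k < r]. *)
have k_unit : (k%:R : 'Z_r) \is a GRing.unit.
  have k_gt0 : (0 < k)%N.
    have /set0Pn[[v t] Avt] := A0; rewrite /k (card_fibre_const _ v).
    by apply/card_gt0P; exists t; rewrite inE.
  have k_lt : (k < r)%N.
    have /set0Pn[[v t] Bvt] := B0; rewrite /k (card_fibre_const _ v).
    rewrite -[X in (_ < X)%N](card_Zp_prime r_pr).
    apply/proper_card/properP; split; first exact/subsetP.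
    by exists t; rewrite // inE (disjointFl dAB Bvt).
  by rewrite unitZpE // prime_coprime // gtnNdvd.
apply: (mulIr k_unit); rewrite !mulr_natr.
pose F v := \sum_(t in fibre v) t.
apply: (coboundary_const (F := F) (psi := fun v => Phi0 v *+ k)) => z y b a.
rewrite /F (fibreD z y b a) big_imset /=; last by move=> ? ? _ _; apply: addIr.
by rewrite big_split sumr_const /k (card_fibre_const (0, 0) (y, b)).
Qed.
End TripleOp.

Theorem theorem4p8 (p q r : nat)
  (p_pr : prime p) (q_pr : prime q) (r_pr : prime r)
  (p_neq_q : p <> q) (p_neq_r : p <> r) (q_neq_r : q <> r)
  (xi : 'Z_q) (xi_unit : xi \is a GRing.unit) (xi_p : xi ^+ p = 1) :
  (forall (X : finType) (op : X -> X -> X),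
     cycle_set op -> indecomposable op -> #|X| = (p * q * r)%N ->
     isomorphic (@ret_op X op)
       (ext_op (fun x y : 'Z_p => zpow xi (y - x))) ->
     exists Phi0 : 'Z_p * 'Z_q -> 'Z_r,
       nonconstant Phi0 /\ isomorphic op (triple_op xi Phi0))
  /\
  (forall Phi0 : 'Z_p * 'Z_q -> 'Z_r,
     nonconstant Phi0 ->
     cycle_set (triple_op xi Phi0) /\ indecomposable (triple_op xi Phi0)).
Proof.
split=> [X op cs ind cardX [F [F' FK F'K] F_op] | Phi0 ncPhi]; last first.
  by split; [apply: triple_op_cycle_set | apply: triple_op_indecomposable].
pose P u := F (ret_class op u).
apply: (extension_form p_pr q_pr r_pr p_neq_r q_neq_r xi_p ind cardX (P := P)).
- by move=> u v; rewrite /P -F_op ret_opE.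
- move=> u v; split=> [/(can_inj FK)/ret_classP/same_sigmaP uv | uv].
    by apply/permP => z; rewrite !sigmaE.
  congr F; apply/ret_classP/same_sigmaP => z.
  by rewrite -!(sigmaE cs) uv.
- by move=> y; exists (generic_quotient.repr (F' y)); rewrite /P repr_classK F'K.
Qed.
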